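(* Let $X$ be a Banach space with the Daugavet property. Then there exists an equivalent norm on $X$ for which $X$ has the super alternative Daugavet property and fails the Daugavet property.
   Context: Banach spaces are non-zero and over $\mathbb{K}$ ($\mathbb{R}$ or $\mathbb{C}$); $B_X$, $S_X$ denote the closed unit ball and the unit sphere of $X$; $\mathbb{T}=\{\theta\in\mathbb{K}:|\theta|=1\}$. $X$ has the Daugavet property if $\|\mathrm{Id}+T\|=1+\|T\|$ for every bounded rank-one operator $T\colon X\to X$. $X$ has the super alternative Daugavet property (super ADP) if for every $x\in S_X$ and every non-empty relatively weakly open subset $W$ of $B_X$ with $W\cap S_X\neq\emptyset$, one has $\sup_{y\in W}\max_{\theta\in\mathbb{T}}\|x+\theta y\|=2$. *)

(* Defs.v *)
From HB Require Import structures.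
From mathcomp Require Import all_boot all_order all_algebra.
From mathcomp Require Import all_classical all_reals all_analysis.
From mathcomp Require Import complex.

Set Implicit Arguments.
Unset Strict Implicit.
Unset Printing Implicit Defensive.

Import Order.TTheory GRing.Theory Num.Theory.
Import numFieldNormedType.Exports.

Local Open Scope classical_set_scope.
Local Open Scope ring_scope.

Definition real_or_complex (R : realType) (K : numFieldType) : Prop :=
  K = (R : numFieldType) \/ K = (complex R : numFieldType).

(* In MathComp the norm of a normedModType K takes its values in K, also when
   K is the field of complex numbers. There, x <= y means that y - x is a
   nonnegative real, so the supremum of a nonempty bounded set of norms is the
   usual one. [supremum 0 A] is the least upper bound of A. *)

Section NormedSpace.
Context {K : numFieldType} (X : normedModType K).

Definition unit_ball : set X := [set x | `|x| <= 1].
Definition unit_sphere : set X := [set x | `|x| = 1].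
Definition unit_scalars : set K := [set t | `|t| = 1].

Definition opnorm (f : X -> X) : K := supremum 0 [set `|f x| | x in unit_ball].

Definition rank_one (T : X -> X) : Prop :=
  exists2 u : X, u != 0 & range T = range (fun a : K => a *: u).

Definition Daugavet : Prop :=
  forall T : {linear X -> X}, bounded_near T (nbhs (0 : X)) -> rank_one T ->
    opnorm (fun x => x + T x) = 1 + opnorm T.

Definition topological_dual : Type :=
  {f : {linear X -> K^o} | continuous f}.

Definition weak_space : Type :=
  sup_topology (fun f : topological_dual =>
    Topological.on (initial_topology (sval f : X -> K^o))).

HB.instance Definition _ := Topological.on weak_space.

Definition weakly_open (U : set X) : Prop := open (U : set weak_space).

Definition relatively_weakly_open_ball (W : set X) : Prop :=
  exists2 U : set X, weakly_open U & W = U `&` unit_ball.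

(* The inner supremum is over a compact set of scalars: it is a maximum. *)
Definition super_ADP : Prop :=
  forall (x : X) (W : set X), unit_sphere x ->
    relatively_weakly_open_ball W -> W `&` unit_sphere !=set0 ->
    supremum 0 [set supremum 0 [set `|x + t *: y| | t in unit_scalars]
               | y in W] = 2.

End NormedSpace.

Record equiv_norm (K : numFieldType) (X : normedModType K) := EquivNorm {
  enorm :> X -> K;
  enormD : forall x y, enorm (x + y) <= enorm x + enorm y;
  enormZ : forall (a : K) x, enorm (a *: x) = `|a| * enorm x;
  enorm0_eq0 : forall x, enorm x = 0 -> x = 0;
  enorm_equiv : exists c C : K, [/\ 0 < c, 0 < C &
    forall x, c * `|x| <= enorm x /\ enorm x <= C * `|x|]
}.

(* The vector space X endowed with the norm N and the topology it induces. *)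
Definition renorm (K : numFieldType) (X : normedModType K)
  (N : equiv_norm X) : Type := X.

Section Renorm.
Context {K : numFieldType} {X : normedModType K} (N : equiv_norm X).

HB.instance Definition _ := GRing.Lmodule.on (renorm N).
HB.instance Definition _ := Lmodule_isNormed.Build K (renorm N)
  (@enormD _ _ N) (@enormZ _ _ N) (@enorm0_eq0 _ _ N).

End Renorm.

(* Main.v *)
Require Import Defs.
From HB Require Import structures.
From mathcomp Require Import all_boot all_order all_algebra.
From mathcomp Require Import all_classical all_reals all_analysis.
From mathcomp Require Import complex ring lra.

Set Implicit Arguments.
Unset Strict Implicit.
Unset Printing Implicit Defensive.

Import Order.TTheory GRing.Theory Num.Theory.
Import numFieldNormedType.Exports.

Local Open Scope classical_set_scope.
Local Open Scope ring_scope.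

(* Choose a bounded functional f and a vector x0 with f x0 = 1; the new norm
   |x - f(x) x0| + |f(x)| makes X the l1-sum of a line and the hyperplane ker f.
   It fails the Daugavet property because x |-> x - f(x) x0 is a contraction.
   For the super ADP, a unimodular scalar aligns the components on the line, and
   those in ker f are aligned by moving one of them within its weak
   neighbourhood. This is possible because the Daugavet property provides,
   inside any slice of the ball, vectors almost aligned with a given vector,
   hence also inside convex combinations of slices, and each point of the ball
   is weakly close to a convex combination of points having weakly small slice
   neighbourhoods. The last fact is proved by a Frank-Wolfe descent for a
   seminorm given by finitely many functionals: points of the ball almost
   farthest from a remote center lie in small slices. *)

(** * The scalar field *)

(* A common view of K = R ([imu = 0]) and K = C ([imu = i]). *)
Record real_scalars (R : realType) (K : numFieldType) := RealScalars {
  emb : {rmorphism R -> K};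
  re : K -> R;
  imu : K;
  ler_emb : forall r s, (emb r <= emb s) = (r <= s);
  reD : forall a b, re (a + b) = re a + re b;
  re_embM : forall r a, re (emb r * a) = r * re a;
  re1 : re 1 = 1;
  emb_re : forall a, 0 <= a -> emb (re a) = a;
  re_le_norm : forall a, re a <= re `|a|;
  imuP : imu = 0 \/ imu * imu = -1;
  emb_reE : forall a, a = emb (re a) - imu * emb (re (imu * a))
}.

Lemma real_real_scalars (R : realType) : real_scalars R R.
Proof.
refine (@RealScalars R R idfun idfun 0 _ _ _ _ _ _ _ _) => //=.
- by move=> a; exact: ler_norm.
- by left.
- by move=> a; rewrite mul0r subr0.
Qed.

Lemma complex_real_scalars (R : realType) :
  real_scalars R (complex R : numFieldType).
Proof.
refine (@RealScalars R (complex R) (real_complex R) (@complex.Re R) 'i%C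
  _ _ _ _ _ _ _ _).
- by move=> r s; rewrite lecR.
- by case=> ? ? [? ?].
- by move=> r [a b] /=; rewrite mul0r subr0.
- by [].
- by move=> a a0; apply: RRe_real; exact: ger0_real.
- move=> a; rewrite normc_def /= (le_trans (ler_norm _))// -sqrtr_sqr.
  by rewrite ler_wsqrtr// lerDl sqr_ge0.
- by right; rewrite -expr2 sqr_i.
- case=> a b; apply/eqP; rewrite eq_complex /=; apply/andP.
  by split; apply/eqP; ring.
Qed.

Lemma real_scalars_exists (R : realType) (K : numFieldType) :
  real_or_complex R K -> inhabited (real_scalars R K).
Proof.
move=> [->|->]; [exact/inhabits/real_real_scalars|].
exact/inhabits/complex_real_scalars.
Qed.

Section RealScalars.
Context {R : realType} {K : numFieldType} (S : real_scalars R K).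
Local Notation emb := (emb S).
Local Notation re := (re S).
Local Notation imu := (imu S).
Implicit Types (r s : R) (a b : K).

Lemma re_emb r : re (emb r) = r.
Proof. by rewrite -[emb r]mulr1 re_embM re1 mulr1. Qed.

Lemma re0 : re 0 = 0.
Proof. by rewrite -(rmorph0 emb) re_emb. Qed.

Lemma reN a : re (- a) = - re a.
Proof. by apply/eqP; rewrite -addr_eq0 -reD addNr re0. Qed.

(** Norms take values in [K]; this real copy lives in the total order of [R], where suprema and
    linear arithmetic are at hand. *)
Definition nrm {V : normedZmodType K} (x : V) : R := re `|x|.

Lemma emb_nrm {V : normedZmodType K} (x : V) : emb (nrm x) = `|x|.
Proof. by rewrite emb_re. Qed.

Lemma le_nrm_emb {V : normedZmodType K} (x : V) r :
  (`|x| <= emb r) = (nrm x <= r).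
Proof. by rewrite -emb_nrm ler_emb. Qed.

Lemma nrm_eqP {V : normedZmodType K} (x : V) r : `|x| = emb r <-> nrm x = r.
Proof. by split=> [xr|<-]; rewrite ?emb_nrm// /nrm xr re_emb. Qed.

Lemma nrm_le1 {V : normedZmodType K} (x : V) : (`|x| <= 1) = (nrm x <= 1).
Proof. by rewrite -le_nrm_emb rmorph1. Qed.

Lemma nrm_eq1 {V : normedZmodType K} (x : V) : `|x| = 1 <-> nrm x = 1.
Proof. by rewrite -nrm_eqP rmorph1. Qed.

Lemma nrm1 : nrm (1 : K) = 1.
Proof. exact/nrm_eq1/normr1. Qed.

Lemma nrm_ge0 {V : normedZmodType K} (x : V) : 0 <= nrm x.
Proof. by rewrite -(ler_emb S) rmorph0 emb_nrm. Qed.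

Lemma nrmD {V : normedZmodType K} (x y : V) : nrm (x + y) <= nrm x + nrm y.
Proof. by rewrite -(ler_emb S) rmorphD /= !emb_nrm ler_normD. Qed.

Lemma nrmN {V : normedZmodType K} (x : V) : nrm (- x) = nrm x.
Proof. by rewrite /nrm normrN. Qed.

Lemma nrm0 {V : normedZmodType K} : nrm (0 : V) = 0.
Proof. by rewrite /nrm normr0 re0. Qed.

Lemma nrm0_eq0 {V : normedZmodType K} (x : V) : nrm x = 0 -> x = 0.
Proof. by move/nrm_eqP; rewrite rmorph0 => /normr0_eq0. Qed.

Lemma nrm_gt0 {V : normedZmodType K} (x : V) : x != 0 -> 0 < nrm x.
Proof.
move=> x0; rewrite lt_neqAle nrm_ge0 andbT eq_sym.
by apply: contra_neq x0 => /nrm0_eq0.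
Qed.

Lemma nrmM a b : nrm (a * b) = nrm a * nrm b.
Proof. by apply/nrm_eqP; rewrite normrM rmorphM /= !emb_nrm. Qed.

Lemma nrmZ {V : normedModType K} a (x : V) : nrm (a *: x) = nrm a * nrm x.
Proof. by apply/nrm_eqP; rewrite normrZ rmorphM /= !emb_nrm. Qed.

Lemma nrm_emb r : nrm (emb r) = `|r|.
Proof.
apply/nrm_eqP; case: (ger0P r) => r0; last first.
  by rewrite -normrN -rmorphN ger0_norm// -(rmorph0 emb) ler_emb oppr_ge0 ltW.
by rewrite ger0_norm// -(rmorph0 emb) ler_emb.
Qed.

Lemma nrmZr {V : normedModType K} r (x : V) : nrm (emb r *: x) = `|r| * nrm x.
Proof. by rewrite nrmZ nrm_emb. Qed.

Lemma re_le_nrm a : `|re a| <= nrm a.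
Proof.
rewrite ler_norml lerNl -reN; apply/andP; split; last exact: re_le_norm.
by rewrite -nrmN; exact: re_le_norm.
Qed.

(** Lets the real parts of [f] and [imu * f] control a scalar functional [f]. *)
Lemma nrm_le_re a : nrm a <= `|re a| + `|re (imu * a)|.
Proof.
rewrite {1}(emb_reE S a) (le_trans (nrmD _ _))// nrm_emb lerD2l nrmN nrmM.
rewrite nrm_emb ler_piMl//.
case: (imuP S) => [->|jj]; first by rewrite nrm0.
have : nrm imu * nrm imu = 1 by rewrite -nrmM jj nrmN nrm1.
by move=> h; have := nrm_ge0 imu; nra.
Qed.

Lemma rotate a : exists t, nrm t = 1 /\ t * a = `|a|.
Proof.
have [->|a0] := eqVneq a 0; first by exists 1; rewrite mulr0 normr0 nrm1.
exists (`|a| / a); split; last by rewrite divfK.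
by apply/nrm_eq1; rewrite normrM normr_id normfV mulfV// normr_eq0.
Qed.

(** The order of [K] is partial, but an upper bound in [K] of a nonempty set of real scalars differs
    from one of them by a nonnegative scalar, so it is real. Suprema in [K] thus reduce to suprema
    in [R]. *)
Lemma supremum_emb (T : Type) (D : set T) (h : T -> K) (g : T -> R) C :
  D !=set0 -> (forall x, D x -> h x = emb (g x)) ->
  (forall x, D x -> g x <= C) ->
  exists r, [/\ supremum 0 [set h x | x in D] = emb r,
    forall x, D x -> g x <= r &
    forall e, 0 < e -> exists2 x, D x & r - e < g x].
Proof.
move=> [x0 Dx0] hg gC; pose A := [set g x | x in D].
have A0 : A !=set0 by exists (g x0), x0.
have Aub : has_ubound A by exists C => _ [x Dx <-]; exact: gC.
exists (sup A); split; last 2 first.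
- by move=> x Dx; apply: ub_le_sup => //; exists x.
- move=> e e0; have [//|_ [x Dx <-] ?] := @sup_adherent _ A e e0 _.
  by exists x.
have sA : supremums [set h x | x in D] (emb (sup A)).
  split=> [_ [x Dx <-]|b hb].
    by rewrite hg// ler_emb ub_le_sup//; exists x.
  have bh x : D x -> 0 <= b - emb (g x).
    by move=> Dx; rewrite subr_ge0 -hg//; apply: hb; exists x.
  have bE : b = emb (re b).
    have /(emb_re S) := bh _ Dx0; rewrite reD reN re_emb rmorphB /= => /addIr.
    by move=> ->.
  rewrite bE ler_emb; apply: ge_sup => // _ [x Dx <-].
  by rewrite -(ler_emb S) -bE -subr_ge0 bh.
(* [supremum] returns its default on the empty set; otherwise it picks some least upper bound, which
   is unique. *)
rewrite /supremum ifF; last first.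
  by apply/eqP => /seteqP[+ _] => /(_ (h x0)); apply; exists x0.
case: xgetP => [y _ Ay|/(_ _ sA)//].
exact: is_subset1_supremums Ay sA.
Qed.

Lemma opnorm_emb {V : normedModType K} (f : V -> V) C :
  (forall x, nrm x <= 1 -> nrm (f x) <= C) ->
  exists r, [/\ opnorm f = emb r, forall x, nrm x <= 1 -> nrm (f x) <= r &
    forall e, 0 < e -> exists2 x, nrm x <= 1 & r - e < nrm (f x)].
Proof.
move=> fC.
have [|x _|x|r [h1 h2 h3]] := @supremum_emb V (@unit_ball K V) (fun x => `|f x|)
    (fun x => nrm (f x)) C.
- by exists 0; rewrite /unit_ball /= normr0.
- by rewrite emb_nrm.
- by rewrite /unit_ball /= nrm_le1; exact: fC.
exists r; split=> // [x x1|e /h3[x xB ?]].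
  by apply: h2; rewrite /unit_ball /= nrm_le1.
by exists x => //; rewrite -nrm_le1.
Qed.

End RealScalars.

(** * From rank-one operators to slices *)

Section Slices.
Context {R : realType} {K : numFieldType} (S : real_scalars R K).
Context {X : normedModType K}.
Local Notation emb := (emb S).
Local Notation re := (re S).
Local Notation nrm := (nrm S).
Implicit Types (r s : R) (a b : K) (x y z u v : X).

(** Unbundled, with a bound in the original norm, so that functionals continuous for an equivalent
    norm fit as well. *)
Definition bounded_functional (f : X -> K) :=
  (forall a x y, f (a *: x + y) = a * f x + f y) /\
  exists C, forall x, nrm (f x) <= C * nrm x.

Section BoundedFunctional.
Variables (f : X -> K) (fP : bounded_functional f).

Lemma bfD x y : f (x + y) = f x + f y.
Proof. by have := fP.1 1 x y; rewrite scale1r mul1r. Qed.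

Lemma bf0 : f 0 = 0.
Proof. by apply: (addrI (f 0)); rewrite -bfD !addr0. Qed.

Lemma bfZ a x : f (a *: x) = a * f x.
Proof. by have := fP.1 a x 0; rewrite !addr0 bf0 addr0. Qed.

Lemma bfN x : f (- x) = - f x.
Proof. by rewrite -scaleN1r bfZ mulN1r. Qed.

Lemma bfB x y : f (x - y) = f x - f y.
Proof. by rewrite bfD bfN. Qed.

Lemma bf_sup : exists r, (forall x, nrm x <= 1 -> nrm (f x) <= r) /\
  (forall e, 0 < e -> exists2 x, nrm x <= 1 & r - e < nrm (f x)).
Proof.
have [C fC] := fP.2.
have [||x x1|r [_ h1 h2]] := @supremum_emb _ _ S X [set x | nrm x <= 1]
    (fun x => emb (nrm (f x))) (fun x => nrm (f x)) `|C|.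
- by exists 0; rewrite /= nrm0.
- by [].
- rewrite (le_trans (fC x))// (le_trans (ler_wpM2r (nrm_ge0 S x) (ler_norm C)))//.
  by rewrite ler_piMr.
by exists r.
Qed.

Lemma bf_le r : (forall x, nrm x <= 1 -> nrm (f x) <= r) ->
  forall x, nrm (f x) <= r * nrm x.
Proof.
move=> fr x; have [->|x0] := eqVneq x 0; first by rewrite bf0 !nrm0 mulr0.
have nx := nrm_gt0 S x0.
have := fr (emb (nrm x)^-1 *: x); rewrite bfZ nrmZr nrmM nrm_emb.
by rewrite ger0_norm ?invr_ge0 ?nrm_ge0// mulVf ?gt_eqF// mulrC ler_pdivrMr//; exact.
Qed.

End BoundedFunctional.

Hypothesis hX : Daugavet X.

(** With [r] the norm of [g], the operator [y |-> g y *: u] has norm [r * nrm u]; the point [y]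
    nearly attains the norm of its sum with the identity. *)
Lemma Daugavet_rank_one (g : X -> K) (z u : X) r e :
  bounded_functional g -> g z != 0 -> u != 0 -> 0 < e ->
  (forall x, nrm x <= 1 -> nrm (g x) <= r) ->
  (forall e, 0 < e -> exists2 x, nrm x <= 1 & r - e < nrm (g x)) ->
  exists2 y, nrm y <= 1 & 1 + r * nrm u - e < nrm (y + g y *: u).
Proof.
move=> gP gz u0 e0 gr rg.
pose T : X -> X := fun y => g y *: u.
have Tlin : linear T by move=> a x y; rewrite /T gP.1 scalerDl scalerA.
pose T' : {linear X -> X} := HB.pack T (@GRing.isLinear.Build K X X _ T Tlin).
have Tr x : nrm x <= 1 -> nrm (T x) <= r * nrm u.
  by move=> x1; rewrite /T nrmZ ler_wpM2r ?nrm_ge0// gr.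
have Tbd : bounded_near T' (nbhs (0 : X)).
  apply/linear_boundedP; near=> M => x.
  have -> : T' x = g x *: u by [].
  rewrite normrZ -!(emb_nrm S) -rmorphM /=.
  apply: (@le_trans _ _ (emb (r * nrm u) * emb (nrm x))).
    rewrite -rmorphM ler_emb mulrAC ler_wpM2r ?nrm_ge0//.
    exact: bf_le.
  apply: ler_wpM2r; first by rewrite emb_nrm.
  near: M; apply: nbhs_pinfty_ge; rewrite realE.
  by rewrite -(rmorph0 emb) !ler_emb -realE num_real.
have T1 : rank_one T'.
  exists u => //; apply/seteqP; split=> [_ [y _ <-]|_ [a _ <-]]; first by exists (g y).
  by exists ((a / g z) *: z) => //=; rewrite /T bfZ// divfK.
have [rT [T1E Tle Tadh]] := opnorm_emb Tr.
have Ir x : nrm x <= 1 -> nrm (x + T x) <= 1 + r * nrm u.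
  by move=> x1; rewrite (le_trans (nrmD _ _ _))// lerD// Tr.
have [rI [I1E Ile Iadh]] := opnorm_emb Ir.
have := hX Tbd T1; rewrite I1E T1E -(rmorph1 emb) -rmorphD => /eqP.
rewrite eq_le !ler_emb -eq_le => /eqP rIE.
have rTr : r * nrm u <= rT.
  apply/ler_addgt0Pl => d d0.
  have [|y y1] := rg (d / nrm u); first by rewrite divr_gt0// nrm_gt0.
  rewrite ltrBlDl => ry; have := Tle _ y1; rewrite /T nrmZ => yT.
  have := nrm_gt0 S u0 => un.
  have : r * nrm u < (d / nrm u + nrm (g y)) * nrm u by rewrite ltr_pM2r.
  by rewrite mulrDl divfK ?gt_eqF// => /ltW/le_trans; apply; rewrite lerD2l.
have [y y1 yI] := Iadh _ e0; exists y => //.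
by apply: le_lt_trans yI; rewrite rIE lerB// lerD2l.
Unshelve. all: by end_near.
Qed.

(** For [t <= s], subtract [(s - t) y] from [s (v + y)]: the norm is at least [s (2 - c) - (s - t)],
    hence at least [(s + t) (1 - c)]. The other case is symmetric. *)
Lemma nrm_ge_near2 v y c s t : nrm v <= 1 -> nrm y <= 1 -> 2 - c <= nrm (v + y) ->
  0 <= c -> 0 <= s -> 0 <= t ->
  (s + t) * (1 - c) <= nrm (emb s *: v + emb t *: y).
Proof.
have main v' y' s' t' : nrm y' <= 1 -> 2 - c <= nrm (v' + y') -> 0 <= c ->
    0 <= t' -> t' <= s' -> (s' + t') * (1 - c) <= nrm (emb s' *: v' + emb t' *: y').
  move=> y1 vy c0 t0 ts.
  have := nrmD S (emb s' *: v' + emb t' *: y') (emb (s' - t') *: y').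
  rewrite -addrA -scalerDl -rmorphD [t' + _]addrC subrK -scalerDr !nrmZr.
  rewrite !ger0_norm ?subr_ge0 ?(le_trans t0)// => h.
  have : s' * (2 - c) <= s' * nrm (v' + y') by rewrite ler_wpM2l// (le_trans t0).
  have : (s' - t') * nrm y' <= (s' - t') by rewrite ler_piMr// subr_ge0.
  nra.
move=> v1 y1 vy c0 s0 t0.
have [st|/ltW st] := leP t s; first exact: main.
by rewrite (addrC s) [X in nrm X]addrC; apply: main => //; rewrite (addrC y).
Qed.

(** With [v = x / nrm x] and [r] the norm of [g], the operator [y |-> (g y / r) v] yields [y] such
    that [y + (g y / r) v] has norm near 2. Then [nrm (g y)] is near [r], and a rotation making
    [g y] positive puts [y] in the slice, almost aligned with [v]. *)
Lemma Daugavet_slice_neq0 (g : X -> K) (y0 x : X) (l al e : R) :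
  bounded_functional g -> nrm y0 <= 1 -> al < re (g y0) -> x != 0 -> 0 <= l ->
  0 < e ->
  exists y, [/\ nrm y <= 1, al < re (g y) &
    nrm x + l - e < nrm (x + emb l *: y)].
Proof.
move=> gP y01 aly0 x0 l0 e0.
have nx := nrm_gt0 S x0.
pose v := emb (nrm x)^-1 *: x.
have v1 : nrm v = 1.
  by rewrite nrmZr ger0_norm ?invr_ge0 ?nrm_ge0// mulVf ?gt_eqF.
have xv : x = emb (nrm x) *: v.
  by rewrite /v scalerA -rmorphM divff ?gt_eqF// rmorph1 scale1r.
clearbody v.
(* If [g = 0], the slice is the whole ball and [v] is aligned with [x]. *)
have [[z gz]|g0] := pselect (exists z, g z != 0); last first.
  have g0' z : g z = 0 by apply: contrapT => /eqP gz; apply: g0; exists z.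
  exists v; rewrite v1 g0' -(g0' y0); split=> //.
  rewrite {2}xv -scalerDl -rmorphD nrmZr v1 mulr1 ger0_norm; last first.
    by rewrite addr_ge0// ltW.
  by rewrite gtrBl.
have [r [gr rg]] := bf_sup gP.
have gle := bf_le gP gr.
have r0 : 0 < r.
  have := gle z; have := nrm_gt0 S gz; have := nrm_ge0 S z.
  by move=> h1 h2 h3; rewrite ltNge; apply/negP => r0; nra.
have alr : al < r.
  apply: (lt_le_trans aly0); apply: le_trans (gr _ y01).
  exact: le_trans (ler_norm _) (re_le_nrm _ _).
(* The first bound keeps the final loss [2 * c * (nrm x + l)] below [e]; the second keeps
   [r * (1 - c)] above [al]. *)
pose c := Num.min (e / (4 * (nrm x + l))) ((r - al) / (2 * r)).
have c0 : 0 < c.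
  rewrite lt_min !divr_gt0 ?subr_gt0 ?mulr_gt0//.
  by rewrite ltr_wpDr.
have ce : c * (4 * (nrm x + l)) <= e.
  rewrite -ler_pdivlMr ?ge_min ?lexx//.
  by rewrite mulr_gt0// ltr_wpDr.
have cr : c * (2 * r) <= r - al.
  by rewrite -ler_pdivlMr ?ge_min ?lexx ?orbT// mulr_gt0.
have v0 : v != 0.
  by apply/eqP => v0; move: v1; rewrite v0 nrm0 => /eqP; rewrite eq_sym oner_eq0.
have u0 : emb r^-1 *: v != 0.
  rewrite scaler_eq0 (negPf v0) orbF; apply/eqP => /(congr1 re).
  by rewrite re_emb re0 => /eqP; rewrite invr_eq0 gt_eqF.
have [y y1] := Daugavet_rank_one gP gz u0 c0 gr rg.
rewrite nrmZr v1 ger0_norm ?invr_ge0 ?ltW// mulr1 divff ?gt_eqF// => gy.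
have [t [t1 tg]] := rotate S (g y).
rewrite -(emb_nrm S) in tg.
set d := nrm (g y) in tg.
have dr : d <= r by exact: gr.
have dc : r * (1 - c) < d.
  have := lt_le_trans gy (nrmD S _ _).
  rewrite nrmZ nrmZr v1 mulr1 ger0_norm ?invr_ge0 ?ltW// => h.
  have {}h : 1 - c < d / r by rewrite -/d in h; lra.
  by rewrite mulrC -ltr_pdivlMr.
exists (t *: y); rewrite nrmZ t1 mul1r; split=> //.
  by rewrite (bfZ gP) [X in re X]tg re_emb; apply: lt_trans dc; nra.
(* One [c] is lost in [gy], another in replacing [d / r] by 1. *)
have near2 : 2 - (2 * c) <= nrm (v + t *: y).
  have E : t *: (y + g y *: (emb r^-1 *: v)) = t *: y + emb (d / r) *: v.
    by rewrite scalerDr !scalerA [X in _ + X *: v]mulrA [X in X * _]tg rmorphM.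
  have E2 : t *: y + emb (d / r) *: v = (v + t *: y) + emb (d / r - 1) *: v.
    rewrite rmorphB rmorph1 scalerBl scale1r [v + _]addrC -!addrA.
    by rewrite [v + _]addrC subrK.
  move: gy; rewrite -[nrm (_ + _)]mul1r -t1 -nrmZ t1 E E2 => gy.
  have := nrmD S (v + t *: y) (emb (d / r - 1) *: v).
  rewrite nrmZr v1 mulr1.
  rewrite distrC ger0_norm; last by rewrite subr_ge0 ler_pdivrMr ?mul1r.
  have : 1 - c < d / r by rewrite ltr_pdivlMr// mulrC.
  lra.
rewrite {2}xv.
apply: lt_le_trans
  (@nrm_ge_near2 v (t *: y) (2 * c) (nrm x) l _ _ _ _ _ _) => //.
- have : 0 < nrm x + l by rewrite ltr_wpDr.
  nra.
- by rewrite v1.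
- by rewrite nrmZ t1 mul1r.
- by rewrite mulr_ge0// ltW.
- exact: ltW.
Qed.

Lemma Daugavet_slice (g : X -> K) (y0 x : X) (l al e : R) :
  (exists u : X, u != 0) ->
  bounded_functional g -> nrm y0 <= 1 -> al < re (g y0) -> 0 <= l -> 0 < e ->
  exists y, [/\ nrm y <= 1, al < re (g y) &
    nrm x + l - e < nrm (x + emb l *: y)].
Proof.
move=> [u u0] gP y01 aly0 l0 e0.
have [->|x0] := eqVneq x 0; last exact: Daugavet_slice_neq0 gP y01 aly0 x0 l0 e0.
have nu := nrm_gt0 S u0.
(* A vector of norm [e / 2] replaces [x = 0]; its norm cancels in the triangle inequality. *)
pose w := emb (e / 2 / nrm u) *: u.
have nw : nrm w = e / 2.
  by rewrite nrmZr ger0_norm ?divr_ge0 ?ltW// divfK ?gt_eqF.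
have e2 : 0 < e / 2 by rewrite divr_gt0.
clearbody w.
have w0 : w != 0 by apply: contra_ltN e2 => /eqP w0; rewrite -nw w0 nrm0.
have [y [y1 aly yw]] := Daugavet_slice_neq0 gP y01 aly0 w0 l0 e2.
exists y; split=> //; have := nrmD S w (emb l *: y).
by rewrite add0r nrm0; rewrite nw in yw *; lra.
Qed.

End Slices.

(** * From slices to the weak topology *)

Section WeakDaugavet.
Context {R : realType} {K : numFieldType} (S : real_scalars R K).
Context {X : normedModType K}.
Local Notation emb := (emb S).
Local Notation re := (re S).
Local Notation nrm := (nrm S).
Implicit Types (x y z v : X) (s t l e : R).

(* The squared seminorms [B x x] for such [B] define the weak topology. *)
Record weak_form (B : X -> X -> R) (M : R) : Prop := WeakForm {
  wfC : forall x y, B x y = B y x;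
  wfD : forall x y z, B (x + y) z = B x z + B y z;
  wfZ : forall r x z, B (emb r *: x) z = r * B x z;
  wf_ge0 : forall x, 0 <= B x x;
  wf_le : forall x, nrm x <= 1 -> B x x <= M;
  wf_dual : forall v, exists2 g : X -> K,
    bounded_functional S g & forall x, re (g x) = B x v
}.

Hypotheses (X_neq0 : exists u : X, u != 0) (hX : Daugavet X).
Variables (B : X -> X -> R) (M : R).
Hypothesis wf : weak_form B M.
Let BC := wfC wf.
Let BD := wfD wf.
Let BZ := wfZ wf.
Let Bge0 := wf_ge0 wf.
Let BM := wf_le wf.
Let Bdual := wf_dual wf.

Lemma BDr x y z : B z (x + y) = B z x + B z y.
Proof. by rewrite BC BD !(BC _ z). Qed.

Lemma BZr r x z : B z (emb r *: x) = r * B z x.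
Proof. by rewrite BC BZ BC. Qed.

Lemma BN x z : B (- x) z = - B x z.
Proof. by rewrite -scaleN1r -(rmorph1 emb) -rmorphN BZ mulN1r. Qed.

Lemma BNr x z : B z (- x) = - B z x.
Proof. by rewrite BC BN BC. Qed.

Let BE := (BDr, BD, BNr, BN, BZr, BZ).

(** Parallelogram identity, without the nonnegative value of the form at [x + y]. *)
Lemma BB_le x y : nrm x <= 1 -> nrm y <= 1 -> B (x - y) (x - y) <= 4 * M.
Proof.
move=> x1 y1; have := BM x1; have := BM y1; have := Bge0 (x + y).
by rewrite !BE (BC y x); lra.
Qed.

(* Vectors of the ball which are weak limits, up to precision [d] in the
   seminorm of [B], of vectors almost aligned with any given [x]. *)
Definition daugavet_near (d : R) : set X := [set z | nrm z <= 1 /\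
  forall x l e, 0 <= l -> 0 < e -> exists y, [/\ nrm y <= 1,
    B (y - z) (y - z) < d & nrm x + l - e < nrm (x + emb l *: y)]].

Lemma ball_conv s x y : 0 <= s -> s <= 1 -> nrm x <= 1 -> nrm y <= 1 ->
  nrm (emb (1 - s) *: x + emb s *: y) <= 1.
Proof.
move=> s0 s1 x1 y1; have := nrmD S (emb (1 - s) *: x) (emb s *: y).
rewrite !nrmZr !ger0_norm ?subr_ge0//; nra.
Qed.

(* Aligning the two summands one after the other is what makes weakly open
   sets reducible to slices. *)
Lemma daugavet_near_conv d s z1 z2 : 0 <= s -> s <= 1 ->
  daugavet_near d z1 -> daugavet_near d z2 ->
  daugavet_near d (emb (1 - s) *: z1 + emb s *: z2).
Proof.
move=> s0 s1 [z11 h1] [z21 h2]; split; first exact: ball_conv.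
move=> x l e l0 e0.
have [||y1 [y11 qy1 ay1]] := h1 x (l * (1 - s)) (e / 2).
- by rewrite mulr_ge0// subr_ge0.
- by rewrite divr_gt0.
have [||y2 [y21 qy2 ay2]] := h2 (x + emb (l * (1 - s)) *: y1) (l * s) (e / 2).
- by rewrite mulr_ge0.
- by rewrite divr_gt0.
exists (emb (1 - s) *: y1 + emb s *: y2); split.
- exact: ball_conv.
- set a := y1 - z1; set b := y2 - z2.
  have -> : emb (1 - s) *: y1 + emb s *: y2 - (emb (1 - s) *: z1 + emb s *: z2) =
      emb (1 - s) *: a + emb s *: b by rewrite !scalerBr opprD addrACA.
  move: qy1 qy2; rewrite -/a -/b; move: a b => a b qy1 qy2.
  (* The value of the form at [(1 - s) a + s b] is the convex combination of its values at [a] and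
     [b], minus this term. *)
  have : 0 <= s * (1 - s) * B (a - b) (a - b).
    by rewrite mulr_ge0// mulr_ge0// subr_ge0.
  rewrite !BE (BC b a).
  (* One of the weights is at least [1 / 2], which keeps the inequality strict. *)
  have : (1 - s) * B a a + s * B b b < d by case: (leP s (1 / 2)) => ?; nra.
  lra.
- by rewrite scalerDr !scalerA -!rmorphM addrA; lra.
Qed.

(* A point of the ball almost farthest from [- t v] lies in a slice of small
   diameter, cut out by the functional [B _ (e + t v)]. *)
Lemma daugavet_near_far d n p v : 0 < d -> 0 < n -> nrm p <= 1 ->
  exists2 e, daugavet_near d e & B p v - n <= B e v.
Proof.
move=> d0 n0 p1.
have M0 : 0 <= M by rewrite (le_trans (Bge0 p))// BM.
(* The estimate of [B (y - e) (y - e)] adds three errors [ta]: one from the choice of [e] as almost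
   farthest, two from the slice, which enters doubled. *)
have [ta ta0 taE] : exists2 ta : R, 0 < ta & 3 * ta = d.
  by exists (d / 3); rewrite ?divr_gt0// mulrC divfK.
(* For large [t] the cross term [2 t B _ v] dominates, so the far point [e] maximizes [B _ v] up to
   [(M + ta) / (2 t) = n]. *)
have [t t0 tE] : exists2 t : R, 0 < t & t * (2 * n) = M + ta.
  exists ((M + ta) / (2 * n)); first by rewrite divr_gt0 ?mulr_gt0// ltr_wpDl.
  by rewrite divfK// gt_eqF// mulr_gt0.
pose E := [set B (c + emb t *: v) (c + emb t *: v) | c in [set c | nrm c <= 1]].
have E0 : E !=set0 by exists (B (p + emb t *: v) (p + emb t *: v)), p.
have Eub : has_ubound E.
  exists (2 * (M + t * t * B v v)) => _ [c /= c1 <-].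
  have := BM c1; have := Bge0 (c - emb t *: v).
  by rewrite !BE (BC v c); lra.
have [//|_ [e /= e1 <-] eE] := @sup_adherent _ E ta ta0 _.
have far c : nrm c <= 1 ->
    B (c + emb t *: v) (c + emb t *: v) < B (e + emb t *: v) (e + emb t *: v) + ta.
  move=> c1; rewrite -ltrBlDr; apply: le_lt_trans eE.
  by rewrite lerB// ub_le_sup//; exists c.
exists e.
- split=> // x l ep l0 ep0.
  have [g gP gB] := Bdual (e + emb t *: v).
  have [|y [y1 ye ay]] := @Daugavet_slice _ _ S X hX g e x l
     (B e (e + emb t *: v) - ta) ep X_neq0 gP e1 _ l0 ep0.
  - by rewrite gB ltrBlDr ltrDl.
  exists y; split=> //; have := far _ y1; move: ye.
  by rewrite gB !BE (BC v e) (BC v y) (BC e y); lra.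
- have := far _ p1; have := BM e1; have := Bge0 p.
  rewrite !BE (BC v e) (BC v p) => h1 h2 h3.
  have : 2 * t * (B p v - n - B e v) <= 0 by lra.
  by rewrite pmulr_rle0 ?mulr_gt0//; lra.
Qed.

(* At a near-minimizer of the distance to [p], a Frank-Wolfe step towards the
   almost maximizer [e] of [B _ (p - z)] would decrease the distance too much. *)
Lemma daugavet_near_dense d n p : 0 < d -> 0 < n -> nrm p <= 1 ->
  exists2 z, daugavet_near d z & B (p - z) (p - z) < n.
Proof.
move=> d0 n0 p1.
pose E := [set B (p - z) (p - z) | z in daugavet_near d].
have M0 : 0 <= M by rewrite (le_trans (Bge0 p))// BM.
have E0 : E !=set0.
  by have [z zG _] := daugavet_near_far 0 d0 n0 p1; exists (B (p - z) (p - z)), z.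
have Elb : has_lbound E by exists 0 => _ [z _ <-]; exact: Bge0.
suff En : inf E < n.
  have [_ [z zG <-] zn] := inf_lt E0 En.
  by exists z.
have [En|nE] := ltP (inf E) n; first by [].
(* The step length: as [B (e - z) (e - z) <= 4 M], this [s] keeps the quadratic term [4 M s^2] below
   [s n / 2]. *)
have [s [s0 s1 sE]] : exists s : R, [/\ 0 < s, s <= 1 & s * (n + 8 * M) = n].
  have nM : 0 < n + 8 * M by rewrite ltr_wpDr// mulr_ge0.
  exists (n / (n + 8 * M)); rewrite divr_gt0// divfK ?gt_eqF//; split=> //.
  by rewrite ler_pdivrMr// mul1r lerDl mulr_ge0.
have sn : 0 < s * n / 4 by rewrite divr_gt0 ?mulr_gt0.
have [_ [z zG <-] zE] := inf_adherent sn (conj E0 Elb).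
have n4 : 0 < n / 4 by rewrite divr_gt0.
have [e eG ev] := daugavet_near_far (p - z) d0 n4 p1.
have wG := daugavet_near_conv (ltW s0) s1 zG eG.
set w := _ + _ in wG.
have wE : inf E <= B (p - w) (p - w) by apply: ge_inf => //; exists w.
have pw : p - w = (p - z) - emb s *: (e - z).
  rewrite /w rmorphB rmorph1 scalerBl scale1r scalerBr !opprD !opprK !addrA.
  by rewrite addrAC.
have ez := BB_le eG.1 zG.1.
have ezB : B p (p - z) - n / 4 - B z (p - z) <= B (e - z) (p - z).
  by rewrite BD BN lerD2r.
have pzB : B p (p - z) - B z (p - z) = B (p - z) (p - z) by rewrite BD BN.
have Ez : inf E <= B (p - z) (p - z) by apply: ge_inf => //; exists z.
(* With [a = p - z] and [b = e - z], the step changes [B a a] by at most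
   [- 2 s (B a a - n / 4) + 4 M s^2]. As [B a a >= n], this is below [- s n], a decrease larger than
   the gap [s n / 4] to the infimum. *)
move: wE zE nE Ez; rewrite pw; move: (p - z) (e - z) ez ezB pzB => a b bb ab aE.
rewrite !BE (BC a b) => wE zE nE Ez.
have h1 : s * (B a a - n / 4) <= s * B b a by rewrite ler_pM2l//; lra.
have h2 : s * s * B b b <= s * s * (4 * M) by rewrite ler_pM2l ?mulr_gt0.
have h3 : s * s * (4 * M) = s * n / 2 - s * s * n / 2.
  have : s * (s * (n + 8 * M)) = s * n by rewrite sE.
  lra.
have h4 : s * n <= s * B a a by rewrite ler_pM2l//; exact: le_trans nE Ez.
have h5 : 0 < s * s * n by rewrite !mulr_gt0.
lra.
Qed.

(** A nearby [daugavet_near] point [z] lends its approximants to [p]; by the parallelogram identity,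
    two errors below [d / 4] add up to less than [d]. *)
Lemma Daugavet_seminorm p x l e d : nrm p <= 1 -> 0 <= l -> 0 < e -> 0 < d ->
  exists y, [/\ nrm y <= 1, B (y - p) (y - p) < d &
    nrm x + l - e < nrm (x + emb l *: y)].
Proof.
move=> p1 l0 e0 d0; have d4 : 0 < d / 4 by rewrite divr_gt0.
have [z [_ zG] pz] := daugavet_near_dense d4 d4 p1.
have [y [y1 yz ay]] := zG x l e l0 e0; exists y; split=> //.
have := Bge0 (y - z + (p - z)).
have -> : y - p = (y - z) - (p - z) by rewrite opprB addrA subrK.
by move: yz pz; rewrite !(BDr (y - z)) !(BD (y - z)) !BNr !BN; lra.
Qed.

End WeakDaugavet.

(** * Weak neighbourhoods described by quadratic forms *)

Section WeakNeighbourhoods.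
Context {R : realType} {K : numFieldType} (S : real_scalars R K).
Context {X : normedModType K}.
Local Notation emb := (emb S).
Local Notation re := (re S).
Local Notation imu := (imu S).
Local Notation nrm := (nrm S).
Implicit Types (x y z v : X) (s t l e : R).

Lemma bf_scale (c : K) (f : X -> K) :
  bounded_functional S f -> bounded_functional S (fun x => c * f x).
Proof.
move=> [fl [C fC]]; split; first by move=> a x y; rewrite fl mulrDr mulrCA.
by exists (nrm c * C) => x; rewrite nrmM -mulrA ler_wpM2l ?nrm_ge0 ?fC.
Qed.

Lemma bf_add (f g : X -> K) : bounded_functional S f -> bounded_functional S g ->
  bounded_functional S (fun x => f x + g x).
Proof.
move=> [fl [C fC]] [gl [D gD]]; split.
  by move=> a x y; rewrite fl gl mulrDr addrACA.
by exists (C + D) => x; rewrite (le_trans (nrmD _ _ _))// mulrDl lerD.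
Qed.

(** Sums stand for intersections of neighbourhoods: a small sum of nonnegative forms makes each of
    them small. *)
Lemma weak_form_add (B1 B2 : X -> X -> R) M1 M2 :
  weak_form S B1 M1 -> weak_form S B2 M2 ->
  weak_form S (fun x y => B1 x y + B2 x y) (M1 + M2).
Proof.
move=> w1 w2; split.
- by move=> x y; rewrite (wfC w1) (wfC w2).
- by move=> x y z; rewrite (wfD w1) (wfD w2) addrACA.
- by move=> r x z; rewrite (wfZ w1) (wfZ w2) mulrDr.
- by move=> x; rewrite addr_ge0// ?(wf_ge0 w1) ?(wf_ge0 w2).
- by move=> x x1; rewrite lerD// ?(wf_le w1) ?(wf_le w2).
- move=> v; have [g1 b1 e1] := wf_dual w1 v; have [g2 b2 e2] := wf_dual w2 v.
  by exists (fun x => g1 x + g2 x); [exact: bf_add|move=> x; rewrite reD e1 e2].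
Qed.

Lemma weak_form_functional (f : X -> K) : bounded_functional S f ->
  exists M, weak_form S (fun x y => re (f x) * re (f y)) M.
Proof.
move=> fP; have [r [fr _]] := bf_sup fP; exists (r * r); split.
- by move=> x y; rewrite mulrC.
- by move=> x y z; rewrite (bfD fP) reD mulrDl.
- by move=> c x z; rewrite (bfZ fP) re_embM mulrA.
- by move=> x; rewrite -expr2 sqr_ge0.
- move=> x x1; have := le_trans (re_le_nrm S (f x)) (fr _ x1).
  rewrite -!expr2 -(real_normK (num_real (re (f x)))) => h.
  by rewrite lerXn2r// nnegrE (le_trans _ h).
- move=> v; exists (fun x => emb (re (f v)) * f x); first exact: bf_scale.
  by move=> x; rewrite re_embM mulrC.
Qed.

(** The form adds the squares of the real parts of [f] and [imu * f]. If their absolute values [p]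
    and [q] satisfy [p^2 + q^2 < e^2 / 4], then [p + q < e], as [(p + q)^2 <= 2 (p^2 + q^2)]. *)
Lemma weak_form_small (f : X -> K) e : bounded_functional S f -> 0 < e ->
  exists B M d, [/\ weak_form S B M, 0 < d & forall y, B y y < d -> nrm (f y) < e].
Proof.
move=> fP e0; have [M1 w1] := weak_form_functional fP.
have [M2 w2] := weak_form_functional (bf_scale imu fP).
eexists _, _, ((e / 2) * (e / 2)); split; first exact: weak_form_add w1 w2.
  by rewrite mulr_gt0// divr_gt0.
move=> y /= h; apply: le_lt_trans (nrm_le_re S (f y)) _.
set u := re (f y) in h *; set v := re _ in h *.
have uu : `|u| * `|u| = u * u by rewrite -normrM ger0_norm// -expr2 sqr_ge0.
have vv : `|v| * `|v| = v * v by rewrite -normrM ger0_norm// -expr2 sqr_ge0.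
have := normr_ge0 u; have := normr_ge0 v; move: h; rewrite -uu -vv.
move: `|u| `|v| => p q h q0 p0.
have := sqr_ge0 (p - q); rewrite expr2 ltNge => sq; apply/negP => pq.
have : e * e <= (p + q) * (p + q) by rewrite ler_pM// ltW.
have : 0 < e * e by rewrite mulr_gt0.
lra.
Qed.

(** The sets containing a ball of some form around [z] are a filter converging weakly to [z]. The
    weak topology is that of the new norm while forms are bounded for the old one; the equivalence
    of the norms bridges the two. *)
Lemma weak_form_nbhs (N : equiv_norm X) (U : set (renorm N)) (z : renorm N) :
  weakly_open U -> U z ->
  exists B M d, [/\ weak_form S B M, 0 < d &
    forall y : X, B (y - z) (y - z) < d -> U y].
Proof.
move=> Uo Uz.
pose F : set_system (renorm N) := [set A | exists B M d,
  [/\ weak_form S B M, 0 < d & forall y : X, B (y - z) (y - z) < d -> A y]].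
(* Yields a form witnessing that the whole space belongs to [F]. *)
have f0 : bounded_functional S (fun _ : X => 0).
  split; first by move=> a x y; rewrite mulr0 addr0.
  by exists 0 => x; rewrite nrm0 mul0r.
have [B0 [M0 [d0 [w0 d00 _]]]] := weak_form_small f0 ltr01.
have FF : Filter F.
  split.
  - by exists B0, M0, d0.
  - move=> P Q [B1 [M1 [d1 [w1 d10 h1]]]] [B2 [M2 [d2 [w2 d20 h2]]]].
    eexists _, _, (Num.min d1 d2); split; first exact: weak_form_add w1 w2.
      by rewrite lt_min d10.
    move=> y; rewrite lt_min => /andP[lt1 lt2].
    have p1 := wf_ge0 w1 (y - z); have p2 := wf_ge0 w2 (y - z).
    by split; [apply: h1; apply: le_lt_trans lt1; rewrite lerDl|
               apply: h2; apply: le_lt_trans lt2; rewrite lerDr].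
  - move=> P Q PQ [B1 [M1 [d1 [w1 d10 h1]]]]; exists B1, M1, d1; split=> // y yd.
    exact/PQ/h1.
have : F --> (z : weak_space (renorm N)).
  (* Convergence in a supremum of topologies is tested on each functional separately. *)
  apply/cvg_sup => f A /=.
  move=> [_ [[D Do <-] Dz] DA].
  have : nbhs (sval f z) D by exact: open_nbhs_nbhs.
  move=> /nbhs_ballP[e /= e0 eD].
  have eE : e = emb (re e) by rewrite emb_re// ltW.
  have re0 : 0 < re e.
    rewrite lt_neqAle -(ler_emb S) rmorph0 -eE ltW// andbT; apply/eqP => h.
    by move: e0; rewrite eE -h rmorph0 ltxx.
  have fP : bounded_functional S (sval f : X -> K).
    split; first by move=> a x y; rewrite linearP.
    have /linear_bounded_continuous/linear_boundedP/pinfty_ex_gt0[L L0 fL] :=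
      proj2_sig f.
    have [c [C [_ C0 NC]]] := enorm_equiv N.
    exists (re (L * C)) => x.
    rewrite -(ler_emb S) rmorphM /= !emb_nrm emb_re; last by rewrite mulr_ge0 ?ltW.
    have fx : `|sval f x : K| <= L * N x := fL x.
    apply: (le_trans fx); rewrite -mulrA ler_pM2l//.
    exact: (NC x).2.
  have [B [M [d [w d0' h]]]] := weak_form_small fP re0.
  exists B, M, d; split=> // y yd.
  apply: DA; apply: eD.
  rewrite -ball_normE /= distrC -linearB eE -(emb_nrm S) lt_neqAle ler_emb.
  have ye := h _ yd; rewrite (ltW ye) andbT.
  apply/eqP => E; have := congr1 re E; rewrite !re_emb => E'.
  by move: ye; rewrite -E' ltxx.
move=> /(_ U); apply.
exact: open_nbhs_nbhs.
Qed.
End WeakNeighbourhoods.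

(** * The Hahn-Banach theorem *)

Section HahnBanach.
Context {R : realType} {K : numFieldType} (S : real_scalars R K).
Context {X : normedModType K}.
Local Notation emb := (emb S).
Local Notation re := (re S).
Local Notation imu := (imu S).
Local Notation nrm := (nrm S).
Implicit Types (x y z v : X) (s t l e : R) (p q : X -> R).

(** The inequality for [r > 0] passes easily to infima; applied to [r^-1] as well, it gives
    equality. *)
Definition sublinear p := (forall x y, p (x + y) <= p x + p y) /\
  (forall r x, 0 < r -> p (emb r *: x) <= r * p x).

Lemma sublinear0 p : sublinear p -> p 0 = 0.
Proof.
move=> [pD pZ]; have := pD 0 0; rewrite addr0.
have := pZ (2^-1) 0; rewrite scaler0 invr_gt0 => /(_ (ltr0Sn _ _)).
lra.
Qed.

Lemma sublinearZ p r x : sublinear p -> 0 < r -> p (emb r *: x) = r * p x.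
Proof.
move=> [_ pZ] r0; apply/le_anti; rewrite pZ//=.
have := pZ r^-1 (emb r *: x); rewrite invr_gt0 => /(_ r0).
rewrite scalerA -rmorphM mulVf ?gt_eqF// rmorph1 scale1r.
by rewrite -(ler_pM2l r0) mulrA divff ?gt_eqF// mul1r.
Qed.

Lemma sublinearN p x : sublinear p -> - p (- x) <= p x.
Proof.
by move=> pS; have := pS.1 x (- x); rewrite subrr (sublinear0 pS); lra.
Qed.

Lemma sublinear_nrm : sublinear nrm.
Proof.
split=> [x y|r x r0]; first exact: nrmD.
by rewrite nrmZr gtr0_norm.
Qed.

(** Serves both [tilt] and the infima of chains; the bound [- p (- x)] keeps the infima finite. *)
Lemma sublinear_inf (T : Type) (A : set T) (h : T -> X -> R) p :
  A !=set0 -> (forall x (t : T), A t -> - p (- x) <= h t x) ->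
  (forall (t1 t2 : T) x y, A t1 -> A t2 ->
    exists2 t, A t & h t (x + y) <= h t1 x + h t2 y) ->
  (forall (t : T) r x, A t -> 0 < r ->
    exists2 t', A t' & h t' (emb r *: x) <= r * h t x) ->
  sublinear (fun x => inf [set h t x | t in A]).
Proof.
move=> [t0 At0] hp hD hZ.
have ne x : [set h t x | t in A] !=set0 by exists (h t0 x), t0.
have lb x (t : T) : A t -> inf [set h t x | t in A] <= h t x.
  by move=> At; apply: ge_inf; [exists (- p (- x)) => _ [u Au <-]; exact: hp|exists t].
split=> [x y|r x r0].
  rewrite -lerBlDr; apply: lb_le_inf => // _ [t1 A1 <-].
  rewrite lerBlDr -lerBlDl; apply: lb_le_inf => // _ [t2 A2 <-].
  have [t At] := hD t1 t2 x y A1 A2.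
  by have := lb (x + y) t At; lra.
rewrite mulrC -ler_pdivrMr//; apply: lb_le_inf => // _ [t At <-].
have [t' At' h'] := hZ t r x At r0.
by rewrite ler_pdivrMr// mulrC (le_trans _ h')// lb.
Qed.

(* The largest sublinear minorant of [p] which is at most [- p y] at [- y]. *)
Definition tilt p y x := inf [set p (x + emb t *: y) - t * p y | t in [set t | 0 <= t]].

Lemma tilt_lb p y x t : sublinear p -> 0 <= t ->
  - p (- x) <= p (x + emb t *: y) - t * p y.
Proof.
move=> pS; rewrite le_eqVlt => /predU1P[<-|t0].
  by rewrite rmorph0 scale0r addr0 mul0r subr0 sublinearN.
rewrite -(sublinearZ _ pS t0); have := pS.1 (x + emb t *: y) (- x).
by rewrite addrAC subrr add0r; lra.
Qed.

Lemma sublinear_tilt p y : sublinear p -> sublinear (tilt p y).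
Proof.
move=> pS; apply: (@sublinear_inf R [set t | 0 <= t]
    (fun t x => p (x + emb t *: y) - t * p y) p).
- by exists 0 => /=.
- by move=> x t; exact: tilt_lb.
- move=> t1 t2 x z /= t10 t20; exists (t1 + t2); first by rewrite /= addr_ge0.
  rewrite rmorphD scalerDl addrACA mulrDl.
  by have := pS.1 (x + emb t1 *: y) (z + emb t2 *: y); lra.
- move=> t r x /= t0 r0; exists (r * t); first by rewrite /= mulr_ge0// ltW.
  by rewrite rmorphM -scalerA -scalerDr (sublinearZ _ pS)// mulrBr mulrA.
Qed.

Lemma tilt_le p y x : sublinear p -> tilt p y x <= p x.
Proof.
move=> pS; apply: ge_inf.
  by exists (- p (- x)) => _ [t t0 <-]; exact: tilt_lb.
by exists 0 => /=; rewrite ?rmorph0 ?scale0r ?addr0 ?mul0r ?subr0.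
Qed.

Lemma tiltN p y : sublinear p -> tilt p y (- y) <= - p y.
Proof.
move=> pS; apply: ge_inf.
  by exists (- p (- - y)) => _ [t t0 <-]; exact: tilt_lb.
exists 1 => /=; first exact: ler01.
by rewrite rmorph1 scale1r addNr (sublinear0 pS) mul1r sub0r.
Qed.

(** Zorn's lemma: the pointwise infimum of a chain is subadditive because any two members are
    comparable. *)
Lemma minimal_sublinear p0 : sublinear p0 -> exists p, [/\ sublinear p,
  forall x, p x <= p0 x &
  forall q, sublinear q -> (forall x, q x <= p x) -> forall x, p x <= q x].
Proof.
move=> p0S.
pose T := {p | sublinear p /\ forall x, p x <= p0 x}.
pose mk q (h : sublinear q /\ forall x, q x <= p0 x) : T := exist _ q h.
(* The order is reversed: maximal elements are pointwise minimal. *)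
pose r (s t : T) := `[< forall x, sval t x <= sval s x >].
have [] := @ZL_preorder T (mk p0 (conj p0S (fun x => lexx _))) r.
- by move=> t; apply/asboolP.
- move=> a b c /asboolP ab /asboolP bc; apply/asboolP => x.
  exact: le_trans (bc x) (ab x).
- move=> A Atot; have [[a0 Aa0]|A0] := pselect (A !=set0); last first.
    exists (mk p0 (conj p0S (fun x => lexx _))) => s As.
    by exfalso; apply: A0; exists s.
  have lbA x a : A a -> - p0 (- x) <= sval a x.
    case: a => a [aS ap] /= _; apply: le_trans (sublinearN _ aS).
    by rewrite lerN2.
  have qA x a : A a -> inf [set sval a x | a in A] <= sval a x.
    move=> Aa; apply: ge_inf; last by exists a.
    by exists (- p0 (- x)) => _ [b Ab <-]; exact: lbA.
  have qS : sublinear (fun x => inf [set sval a x | a in A]).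
    apply: (@sublinear_inf T A (fun a x => sval a x) p0) => //.
    + by exists a0.
    + move=> a b x y Aa Ab; case: (Atot a b Aa Ab) => /asboolP ab.
        exists b => //; apply: le_trans ((svalP b).1.1 x y) _.
        by rewrite lerD2r ab.
      exists a => //; apply: le_trans ((svalP a).1.1 x y) _.
      by rewrite lerD2l ab.
    + by move=> a c x Aa c0; exists a => //; apply: (svalP a).1.2.
  have qp x : inf [set sval a x | a in A] <= p0 x.
    exact: le_trans (qA x _ Aa0) ((svalP a0).2 x).
  by exists (mk _ (conj qS qp)) => s As; apply/asboolP => x; exact: qA.
- move=> [p [pS pp0]] pmax; exists p; split=> // q qS qp.
  have qp0 x : q x <= p0 x by exact: le_trans (qp x) (pp0 x).
  by have /asboolP := pmax (mk q (conj qS qp0)) (introT (asboolP _) qp).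
Qed.

(** A minimal [p] lies below each of its tilts, so [p (- y) <= - p y]; an odd sublinear function is
    additive. Values are prescribed by tilting [p0] beforehand, in place of an extension from a
    subspace. *)
Lemma Hahn_Banach p0 : sublinear p0 -> exists phi : X -> R, [/\
  forall x y, phi (x + y) = phi x + phi y,
  forall r x, phi (emb r *: x) = r * phi x &
  forall x, phi x <= p0 x].
Proof.
move=> p0S; have [p [pS pp0 pmin]] := minimal_sublinear p0S.
have pN y : p (- y) = - p y.
  apply/le_anti/andP; split; last first.
    by have := sublinearN (- y) pS; rewrite opprK.
  apply: (le_trans _ (tiltN y pS)); apply: pmin; first exact: sublinear_tilt.
  by move=> x; exact: tilt_le.
have pD x y : p (x + y) = p x + p y.
  apply/le_anti; rewrite pS.1/=; have := pS.1 (x + y) (- y).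
  by rewrite addrK pN; lra.
exists p; split=> // r x; case: (ltrgtP r 0) => [r0|r0|->].
- by rewrite -[r]opprK rmorphN scaleNr pN (sublinearZ _ pS) ?oppr_gt0// !mulNr.
- exact: sublinearZ.
- by rewrite rmorph0 scale0r (sublinear0 pS) mul0r.
Qed.

Lemma re_imu : re imu = 0.
Proof.
have := emb_reE S 1; rewrite mulr1 re1 rmorph1 => /eqP.
rewrite eq_sym subr_eq addrC -subr_eq subrr eq_sym mulf_eq0 => /orP[/eqP ->|].
  exact: re0.
by rewrite -(rmorph0 emb) => /eqP/(congr1 re); rewrite !re_emb.
Qed.

(** The classical formula [phi x - i phi (i x)]; for [imu = 0] it returns [phi]. *)
Lemma complexify (phi : X -> R) :
  (forall x y, phi (x + y) = phi x + phi y) ->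
  (forall r x, phi (emb r *: x) = r * phi x) ->
  (forall x, phi x <= nrm x) ->
  exists2 f : X -> K, bounded_functional S f & forall x, re (f x) = phi x.
Proof.
move=> phiD phiZ phi1.
have phi0 : phi 0 = 0 by have := phiZ 0 0; rewrite rmorph0 scale0r mul0r.
have phiN x : phi (- x) = - phi x.
  by rewrite -scaleN1r -(rmorph1 emb) -rmorphN phiZ mulN1r.
have phin x : `|phi x| <= nrm x.
  by rewrite ler_norml phi1 andbT lerNl -phiN -(nrmN S).
pose f x := emb (phi x) - imu * emb (phi (imu *: x)).
have fD x y : f (x + y) = f x + f y.
  by rewrite /f scalerDr !phiD !rmorphD /=; ring.
have fZ r x : f (emb r *: x) = emb r * f x.
  have jr : imu *: (emb r *: x) = emb r *: (imu *: x) by rewrite !scalerA mulrC.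
  by rewrite /f jr !phiZ !rmorphM /=; ring.
have fJ x : f (imu *: x) = imu * f x.
  rewrite /f; case: (imuP S) => [->|jj].
    by rewrite !scale0r phi0 rmorph0 !mul0r subr0.
  by rewrite scalerA jj scaleN1r phiN rmorphN mulrBr [imu * (imu * _)]mulrA jj; ring.
have fN x : f (- x) = - f x.
  by rewrite -scaleN1r -(rmorph1 emb) -rmorphN fZ rmorphN rmorph1 mulN1r.
exists f.
  split=> [a x y|].
    rewrite fD; congr (_ + _); rewrite {1}(emb_reE S a) scalerBl fD fN.
    by rewrite -scalerA fJ !fZ mulrA -mulrBl -emb_reE.
  exists (1 + nrm imu * nrm imu) => x; rewrite mulrDl mul1r.
  apply: le_trans (nrmD _ _ _) _; rewrite nrmN nrmM !nrm_emb lerD//.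
  by rewrite -mulrA ler_wpM2l ?nrm_ge0// -nrmZ.
move=> x; rewrite /f reD reN re_emb [imu * _]mulrC re_embM re_imu.
by rewrite mulr0 subr0.
Qed.

(** Tilting the norm at [x] forces [phi (- x) <= - nrm x < 0], so [f x] is non-zero and [f] can be
    rescaled. *)
Lemma exists_functional : (exists x : X, x != 0) ->
  exists (f : X -> K) (x : X), bounded_functional S f /\ f x = 1.
Proof.
move=> [x x0]; have nS := sublinear_nrm.
have [phi [phiD phiZ phi_le]] := Hahn_Banach (sublinear_tilt x nS).
have [|f fP fphi] := complexify phiD phiZ.
  by move=> y; exact: le_trans (phi_le y) (tilt_le _ _ nS).
have fx : f x != 0.
  apply/eqP => fx; have := le_trans (phi_le (- x)) (tiltN x nS).
  rewrite -fphi (bfN fP) fx oppr0 re0 oppr_ge0 leNgt => /negP; apply.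
  exact: nrm_gt0.
exists (fun y => (f x)^-1 * f y), x; split; first exact: bf_scale.
by rewrite mulVf.
Qed.

End HahnBanach.

(** * The renorming *)

Section Renorming.
Context {R : realType} {K : numFieldType} (S : real_scalars R K).
Context {X : normedModType K}.
Local Notation emb := (emb S).
Local Notation re := (re S).
Local Notation nrm := (nrm S).
Implicit Types (x y z v : X) (s t l e d r : R).

Variables (f : X -> K) (x0 : X).
Hypotheses (fP : bounded_functional S f) (fx0 : f x0 = 1).

Lemma nrm_unimodV (t : K) : nrm t = 1 -> t != 0 /\ nrm t^-1 = 1.
Proof.
move=> /nrm_eq1 t1; split; last by apply/nrm_eq1; rewrite normfV t1 invr1.
by rewrite -normr_eq0 t1 oner_eq0.
Qed.

Lemma align (a b : K) : exists t : K, nrm t = 1 /\ nrm (a + t * b) = nrm a + nrm b.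
Proof.
have [ta [ta1 aE]] := rotate S a; have [tb [tb1 bE]] := rotate S b.
have [ta0 taV1] := nrm_unimodV ta1.
exists (ta^-1 * tb); split; first by rewrite nrmM taV1 tb1 mulr1.
have -> : a + ta^-1 * tb * b = ta^-1 * emb (nrm a + nrm b).
  by rewrite rmorphD /= !emb_nrm -aE -bE mulrDr mulKf// mulrA.
by rewrite nrmM taV1 mul1r nrm_emb ger0_norm// addr_ge0 ?nrm_ge0.
Qed.

Lemma weak_form_le (B : X -> X -> R) M x : weak_form S B M ->
  B x x <= M * (nrm x * nrm x).
Proof.
move=> wf; have [->|xn0] := eqVneq x 0.
  by have := wfZ wf 0 0 0; rewrite scaler0 mul0r nrm0 !mulr0 => ->.
have nx := nrm_gt0 S xn0.
pose u := emb (nrm x)^-1 *: x.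
have -> : x = emb (nrm x) *: u.
  by rewrite /u scalerA -rmorphM divff ?gt_eqF// rmorph1 scale1r.
have u1 : nrm u = 1.
  by rewrite nrmZr ger0_norm ?invr_ge0 ?nrm_ge0// mulVf ?gt_eqF.
rewrite (wfZ wf) (wfC wf) (wfZ wf) nrmZr u1 mulr1 ger0_norm ?nrm_ge0// mulrA mulrC.
by rewrite ler_wpM2r ?mulr_ge0 ?nrm_ge0// (wf_le wf)// u1.
Qed.

Lemma x0_neq0 : x0 != 0.
Proof.
by apply/eqP => x00; move: fx0; rewrite x00 (bf0 fP) => /eqP; rewrite eq_sym oner_eq0.
Qed.

Hypothesis hX : Daugavet X.

(* The functional of a hyperplane is weakly continuous, hence vectors that are
   weakly close to the hyperplane are close to it in norm. *)
Lemma Daugavet_hyperplane (B : X -> X -> R) M x z e d :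
  weak_form S B M -> f z = 0 -> nrm z <= 1 -> 0 < e -> 0 < d ->
  exists y, [/\ f y = 0, nrm y <= nrm z, B (y - z) (y - z) < d &
    nrm x + nrm z - e < nrm (x + y)].
Proof.
move=> wf fz z1 e0 d0.
have [->|zn0] := eqVneq z 0.
  exists 0; rewrite (bf0 fP) nrm0 addr0 subr0; split=> //; last by rewrite addr0 gtrBl.
  by have := wfZ wf 0 0 0; rewrite scaler0 mul0r => ->.
have nz := nrm_gt0 S zn0; set l := nrm z in nz z1 *.
(* Working with a unit vector and scaling back by [l] at the end makes the result no longer than
   [z]. *)
pose p := emb l^-1 *: z.
have zp : z = emb l *: p.
  by rewrite /p scalerA -rmorphM divff ?gt_eqF// rmorph1 scale1r.
have p1 : nrm p = 1.
  by rewrite nrmZr ger0_norm ?invr_ge0 ?nrm_ge0// mulVf ?gt_eqF.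
have fp : f p = 0 by rewrite (bfZ fP) fz mulr0.
clearbody p.
have M0 : 0 <= M.
  by apply: le_trans (wf_ge0 wf 0) _; apply: (wf_le wf); rewrite nrm0.
have n0 := nrm_gt0 S x0_neq0.
(* [h] will bound the correction from [y] to a kernel vector [w]: it costs at most [e / 2] in norm
   and, as [h <= 1], at most [M h <= d / 4] in [B]. *)
have [h [h0 h1 he hd]] : exists h : R,
    [/\ 0 < h, h <= 1, h <= e / 2 & h * (4 * (M + 1)) <= d].
  have M4 : 0 < 4 * (M + 1) by rewrite mulr_gt0// ltr_wpDl.
  exists (Num.min 1 (Num.min (e / 2) (d / (4 * (M + 1))))); split.
  - by rewrite !lt_min ltr01 !divr_gt0.
  - by rewrite ge_min lexx.
  - by rewrite !ge_min lexx orbT.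
  - by rewrite -ler_pdivlMr// !ge_min lexx !orbT.
have [|B' [M' [d' [wf' d'0 B'f]]]] :=
  @weak_form_small _ _ S X f (h / (2 * nrm x0)) fP.
  by rewrite divr_gt0// mulr_gt0.
have [||||y [y1 yp ay]] := Daugavet_seminorm (ex_intro _ x0 x0_neq0) hX
  (weak_form_add wf wf') (p := p) x (l := l) (e := e / 2) (d := Num.min (d / 4) d').
- by rewrite p1.
- exact: ltW.
- by rewrite divr_gt0.
- by rewrite lt_min divr_gt0.
move: yp; rewrite lt_min => /andP[yp yp'].
have {}yp : B (y - p) (y - p) < d / 4.
  by apply: le_lt_trans yp; rewrite lerDl (wf_ge0 wf').
have {yp'}fy : nrm (f y) < h / (2 * nrm x0).
  rewrite -[f y]subr0 -fp -(bfB fP); apply: B'f.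
  by apply: le_lt_trans yp'; rewrite lerDr (wf_ge0 wf).
(* Project [y] onto the kernel along [x0], then divide by [k] to return to the ball; each operation
   moves the vector by at most [k - 1]. *)
pose k := 1 + nrm (f y) * nrm x0; pose u := y - f y *: x0.
have k1 : 1 <= k by rewrite lerDl mulr_ge0 ?nrm_ge0.
have k0 : 0 < k by exact: lt_le_trans k1.
have kh : 2 * (k - 1) <= h.
  move: fy; rewrite ltr_pdivlMr ?mulr_gt0// /k => fy.
  by apply: ltW; apply: le_lt_trans fy; rewrite addrC addKr; lra.
have uk : nrm u <= k.
  by apply: le_trans (nrmD _ _ _) _; rewrite nrmN nrmZ lerD.
pose w := emb k^-1 *: u.
have kV : 0 <= k^-1 by rewrite invr_ge0 ltW.
have w1 : nrm w <= 1.
  by rewrite nrmZr ger0_norm// mulrC ler_pdivrMr// mul1r.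
have fw : f w = 0.
  by rewrite (bfZ fP) (bfB fP) (bfZ fP) fx0 mulr1 subrr mulr0.
have wy : nrm (w - y) <= h.
  apply: le_trans kh.
  have uw : u = emb k *: w.
    by rewrite /w scalerA -rmorphM divff ?gt_eqF// rmorph1 scale1r.
  have -> : w - y = emb (1 - k) *: w - f y *: x0.
    by rewrite rmorphB rmorph1 scalerBl scale1r -uw /u opprB addrA addrAC addrK.
  apply: le_trans (nrmD _ _ _) _; rewrite nrmN nrmZr nrmZ distrC ger0_norm ?subr_ge0//.
  have : (k - 1) * nrm w <= k - 1 by rewrite ler_piMr// subr_ge0.
  by rewrite /k; lra.
clearbody w; have l0 := ltW nz.
exists (emb l *: w); split.
- by rewrite (bfZ fP) fw mulr0.
- by rewrite nrmZr ger0_norm ?ler_piMr//.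
- rewrite zp -scalerBr (wfZ wf) (wfC wf) (wfZ wf).
  have ll : l * l <= 1 by rewrite mulr_ile1.
  have q0 := wf_ge0 wf (w - p).
  apply: (@le_lt_trans _ _ (B (w - p) (w - p))).
    by rewrite mulrA ler_piMl.
  have -> : w - p = (w - y) + (y - p) by rewrite addrA subrK.
  have wyB : B (w - y) (w - y) <= d / 4.
    apply: le_trans (weak_form_le _ wf) _.
    have : M * (nrm (w - y) * nrm (w - y)) <= M * h.
      rewrite ler_wpM2l// -[leRHS]mulr1 ler_pM ?nrm_ge0//.
      exact: le_trans wy h1.
    lra.
  move: yp wyB; move: (w - y) (y - p) => a b bb aa.
  have := wf_ge0 wf (a - b).
  rewrite -[in B (a - b) _](scaleN1r b) -(rmorph1 emb) -rmorphN.
  rewrite !(wfD wf) !(wfZ wf) ![B a (_ + _)](wfC wf) ![B b (_ + _)](wfC wf).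
  rewrite !(wfD wf) !(wfZ wf) (wfC wf b a).
  lra.
- have -> : emb l *: w = emb l *: y + emb l *: (w - y).
    by rewrite -scalerDr addrC subrK.
  have := nrmD S (x + (emb l *: y + emb l *: (w - y))) (- (emb l *: (w - y))).
  rewrite addrA addrK nrmN nrmZr ger0_norm// => hh.
  have : l * nrm (w - y) <= h.
    by apply: le_trans wy; rewrite ler_piMl ?nrm_ge0.
  lra.
Qed.

(** The coordinate [f x] is counted without the factor [nrm x0], so that [x0] gets norm 1. *)
Definition l1_norm x : R := nrm (x - f x *: x0) + nrm (f x).

Lemma l1_normD x y : l1_norm (x + y) <= l1_norm x + l1_norm y.
Proof.
rewrite /l1_norm (bfD fP) scalerDl opprD addrACA.
have := nrmD S (x - f x *: x0) (y - f y *: x0).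
have := nrmD S (f x) (f y); lra.
Qed.

Lemma l1_normZ (a : K) x : l1_norm (a *: x) = nrm a * l1_norm x.
Proof. by rewrite /l1_norm (bfZ fP) -scalerA -scalerBr nrmZ nrmM mulrDr. Qed.

Lemma l1_norm0_eq0 x : l1_norm x = 0 -> x = 0.
Proof.
move=> /eqP; rewrite paddr_eq0 ?nrm_ge0// => /andP[/eqP/nrm0_eq0 + /eqP/nrm0_eq0 fx].
by rewrite fx scale0r subr0.
Qed.

Lemma l1_norm_equiv : exists c C : K, [/\ 0 < c, 0 < C &
  forall x, c * `|x| <= emb (l1_norm x) /\ emb (l1_norm x) <= C * `|x|].
Proof.
have [C fC] := fP.2.
have emb_gt0 r : 0 < r -> 0 < emb r.
  move=> r0; rewrite -(rmorph0 emb) lt_neqAle ler_emb (ltW r0) andbT.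
  by apply/eqP => /(congr1 re); rewrite !re_emb => E; move: r0; rewrite -E ltxx.
(* The first constant comes from [x = (x - f x *: x0) + f x *: x0]; the absolute value in the second
   guards against a negative [C]. *)
exists (emb (1 + nrm x0)^-1), (emb (1 + `|C| * nrm x0 + `|C|)); split.
- by rewrite emb_gt0// invr_gt0 ltr_wpDr ?nrm_ge0.
- by rewrite emb_gt0// -addrA ltr_wpDr// addr_ge0// mulr_ge0// nrm_ge0.
move=> x; have n0 := nrm_ge0 S x0.
have fx : nrm (f x) <= `|C| * nrm x.
  by rewrite (le_trans (fC x))// ler_wpM2r ?nrm_ge0// ler_norm.
rewrite -(emb_nrm S) -!rmorphM !ler_emb; split.
  rewrite mulrC ler_pdivrMr ?ltr_wpDr//.
  have := nrmD S (x - f x *: x0) (f x *: x0); rewrite subrK nrmZ /l1_norm.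
  have := nrm_ge0 S (x - f x *: x0); have := nrm_ge0 S (f x); nra.
rewrite /l1_norm; have := nrmD S x (- (f x *: x0)); rewrite nrmN nrmZ.
have : nrm (f x) * nrm x0 <= `|C| * nrm x * nrm x0 by rewrite ler_wpM2r.
lra.
Qed.

Lemma emb_l1_normD x y :
  emb (l1_norm (x + y)) <= emb (l1_norm x) + emb (l1_norm y).
Proof. by rewrite -rmorphD ler_emb l1_normD. Qed.

Lemma emb_l1_normZ (a : K) x : emb (l1_norm (a *: x)) = `|a| * emb (l1_norm x).
Proof. by rewrite l1_normZ rmorphM /= emb_nrm. Qed.

Lemma emb_l1_norm0_eq0 x : emb (l1_norm x) = 0 -> x = 0.
Proof. by move/(congr1 re); rewrite re_emb re0 => /l1_norm0_eq0. Qed.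

Definition l1_equiv_norm : equiv_norm X :=
  EquivNorm emb_l1_normD emb_l1_normZ emb_l1_norm0_eq0 l1_norm_equiv.

Local Notation XN := (renorm l1_equiv_norm).

Lemma nrm_renorm (x : XN) : nrm x = l1_norm x.
Proof. exact: re_emb. Qed.

(** The scalar [t] depends on the line components only, so it is fixed first. Then the kernel
    component of [z] is replaced by a vector [y], no longer and close for [B], almost aligned with
    [t^-1] times that of [x]; the line component of [z] is kept. *)
Lemma l1_super_ADP_approx (B : X -> X -> R) M x z d e :
  weak_form S B M -> 0 < d -> 0 < e -> l1_norm x = 1 -> l1_norm z = 1 ->
  exists y (t : K), [/\ l1_norm y <= 1, B (y - z) (y - z) < d, nrm t = 1 &
    2 - e < l1_norm (x + t *: y)].
Proof.
move=> wf d0 e0 x1 z1.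
have [t [t1 tE]] := align (f x) (f z).
have [t0 tV] := nrm_unimodV t1.
have fk v : f (v - f v *: x0) = 0.
  by rewrite (bfB fP) (bfZ fP) fx0 mulr1 subrr.
have [|y [fy yz By ay]] :=
  Daugavet_hyperplane (t^-1 *: (x - f x *: x0)) wf (fk z) _ e0 d0.
  by rewrite -z1 lerDl nrm_ge0.
exists (y + f z *: x0), t.
have fyz : f (y + f z *: x0) = f z by rewrite (bfD fP) (bfZ fP) fy fx0 mulr1 add0r.
split=> //.
- by rewrite /l1_norm fyz addrK -z1 lerD2r.
- suff -> : y + f z *: x0 - z = y - (z - f z *: x0) by [].
  by rewrite opprB addrA.
rewrite /l1_norm (bfD fP) (bfZ fP) fyz tE.
have -> : x + t *: (y + f z *: x0) - (f x + t * f z) *: x0 =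
    t *: (t^-1 *: (x - f x *: x0) + y).
  rewrite [in RHS]scalerDr [in RHS]scalerA divff// scale1r scalerDr scalerA.
  by rewrite scalerDl opprD [x + _]addrA addrACA subrr addr0 addrAC.
rewrite nrmZ t1 mul1r; rewrite nrmZ tV mul1r in ay.
by move: x1 z1; rewrite /l1_norm; lra.
Qed.

(** The triangle inequality bounds the suprema by 2; approximants near a point [z] of the sphere in
    [W] give the converse. *)
Lemma l1_super_ADP : super_ADP XN.
Proof.
move=> x W /(nrm_eq1 S) x1 [U Uo WU] [z [Wz /(nrm_eq1 S) z1]].
rewrite nrm_renorm in x1; rewrite nrm_renorm in z1.
have W1 y : W y -> l1_norm y <= 1.
  by rewrite WU => -[_]; rewrite /unit_ball /= (nrm_le1 S) nrm_renorm.
have Uz : U z by move: Wz; rewrite WU => -[].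
have [B [M [d [wf d0 BU]]]] := weak_form_nbhs S Uo Uz.
pose inner (y : XN) := supremum 0 [set `|x + t *: y| | t in unit_scalars].
have xty y (t : K) : W y -> unit_scalars t -> l1_norm (x + t *: y) <= 2.
  move=> /W1 y1 /(nrm_eq1 S) t1; apply: le_trans (l1_normD _ _) _.
  by rewrite l1_normZ t1 mul1r x1 lerD2l.
have innerP y : W y -> exists r, [/\ inner y = emb r,
    forall t : K, unit_scalars t -> l1_norm (x + t *: y) <= r & r <= 2].
  move=> Wy.
  have [||t /= ts|r [h1 h2 h3]] := @supremum_emb _ _ S K unit_scalars
    (fun t : K => `|(x + t *: y : XN)|) (fun t : K => l1_norm (x + t *: y)) 2.
  - by exists 1; rewrite /unit_scalars /= normr1.
  - by [].
  - exact: xty.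
  exists r; split=> //; apply/ler_addgt0Pr => e e0.
  have [t ts] := h3 e e0; have := xty y t Wy ts; lra.
have [||y Wy|r [-> h2 h3]] := @supremum_emb _ _ S XN W inner (re \o inner) 2.
- by exists z.
- by move=> y /innerP[r [rE _ _]]; rewrite /= rE re_emb.
- by have [r [/= -> _ r2]] := innerP y Wy; rewrite re_emb.
suff -> : r = 2 by rewrite rmorph_nat.
apply/le_anti/andP; split.
  apply/ler_addgt0Pr => e e0; have [y Wy] := h3 e e0.
  by have [s [/= -> _ s2]] := innerP y Wy; rewrite re_emb; lra.
apply/ler_addgt0Pr => e e0.
have [y [t [y1 yB t1 ty]]] := l1_super_ADP_approx wf d0 e0 x1 z1.
have Wy : W y.
  rewrite WU; split; first exact: BU.
  by rewrite /unit_ball /= (nrm_le1 S) nrm_renorm.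
have := h2 y Wy; have [s [/= -> /(_ t) ts _]] := innerP y Wy; rewrite re_emb.
have := ts (proj2 (nrm_eq1 S t) t1); lra.
Qed.

(** Take for [T] minus the projection onto the line of [x0]: [Id + T] projects onto [ker f] with
    norm at most 1, while [T x0 = - x0] has norm 1. *)
Lemma l1_not_Daugavet : ~ Daugavet XN.
Proof.
move=> D.
pose T : XN -> XN := fun y => - (f y *: x0).
have Tlin : linear T.
  move=> a x y; rewrite /T fP.1 scalerDl opprD -scalerA.
  by rewrite scalerN.
pose T' : {linear XN -> XN} :=
  HB.pack T (@GRing.isLinear.Build K XN XN _ T Tlin).
have TE y : l1_norm (T y) = nrm (f y).
  rewrite /T -scaleNr l1_normZ nrmN /l1_norm fx0 scale1r subrr nrm0 add0r.
  by rewrite nrm1 mulr1.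
have ITE y : l1_norm (y + T y) <= l1_norm y.
  rewrite /l1_norm (bfB fP) (bfZ fP) fx0 mulr1 subrr scale0r subr0 nrm0 addr0.
  by rewrite lerDl nrm_ge0.
have Tle y : l1_norm (T y) <= l1_norm y by rewrite TE lerDr nrm_ge0.
have Tbd : bounded_near T' (nbhs (0 : XN)).
  apply/linear_boundedP; near=> L => y.
  have h : `|(T y : XN)| <= 1 * `|y|.
    by rewrite mul1r -!(emb_nrm S) !nrm_renorm ler_emb.
  apply: le_trans h _; apply: ler_wpM2r; first exact: normr_ge0.
  near: L; exact: nbhs_pinfty_ge.
have T1 : rank_one T'.
  exists x0; first exact: x0_neq0.
  apply/seteqP; split=> [_ [y _ <-]|_ [a _ <-]].
    by exists (- f y) => //=; rewrite /T scaleNr.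
  by exists (- a *: x0) => //=; rewrite /T (bfZ fP) fx0 mulr1 scaleNr opprK.
have [|rI [IE _ Iadh]] := @opnorm_emb _ _ S XN (fun y => y + T y) 1.
  by move=> y; rewrite !nrm_renorm; exact: le_trans.
have [|rT [TEo Tub _]] := @opnorm_emb _ _ S XN T 1.
  by move=> y; rewrite !nrm_renorm; exact: le_trans.
have := D _ Tbd T1; rewrite IE TEo -(rmorph1 emb) -rmorphD => /(congr1 re).
rewrite !re_emb => E.
have l0 : l1_norm x0 = 1.
  by rewrite /l1_norm fx0 scale1r subrr nrm0 add0r nrm1.
have := Tub x0; rewrite !nrm_renorm TE l0 fx0 => /(_ (lexx _)).
rewrite nrm1.
(* A tolerance of 1 suffices: it gives [rI < 2], whereas [rI = 1 + rT >= 2]. *)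
have [y] := Iadh 1 ltr01; rewrite !nrm_renorm => y1.
have := ITE y; lra.
Unshelve. all: by end_near.
Qed.

End Renorming.

Theorem theorem3p3 (R : realType) (K : numFieldType)
    (hK : real_or_complex R K) (X : completeNormedModType K)
    (X_neq0 : exists x : X, x != 0) (hX : Daugavet X) :
  exists N : equiv_norm X, super_ADP (renorm N) /\ ~ Daugavet (renorm N).
Proof.
have [S] := real_scalars_exists hK.
have [f [x0 [fP fx0]]] := exists_functional S X_neq0.
exists (l1_equiv_norm x0 fP); split.
- exact: l1_super_ADP fx0 hX.
- exact: l1_not_Daugavet fx0.
Qed.
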